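(* Let $n\ge1$ and $d_1>0$. Let $b\in\Delta_n=\{1,2,4,7\}^n$ be a base vector different from the identity word $77\cdots7$. Then the three points $$P(b),\qquad P(\gamma b),\qquad P(\gamma^2 b)$$ are the vertices of an equilateral triangle (with three distinct vertices).
   Context: $\gamma$ acts on words digitwise in every position by $1\mapsto2\mapsto4\mapsto1$, $7\mapsto7$. The vectors in $\mathbb R^2$ are $v(1)=(\cos 210^\circ,\sin 210^\circ)$, $v(2)=(\cos 90^\circ,\sin 90^\circ)$, $v(4)=(\cos 330^\circ,\sin 330^\circ)$, $v(7)=(0,0)$. For a fixed scale $d_1>0$ put $d_r=d_1/2^{r-1}$. The centroid map $P:\Delta_n\to\mathbb R^2$ is $P(b)=\sum_{r=1}^n\sigma_r d_r v(b_r)$ for $b=b_1\cdots b_n$, where $\sigma_r=(-1)^{\#\{s<r:\,b_s=7\}}$. *)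

(* Defs.v *)
From HB Require Import structures.
From mathcomp Require Import all_boot all_order all_algebra.
From mathcomp Require Import all_classical all_reals all_analysis.

Set Implicit Arguments.
Unset Strict Implicit.
Unset Printing Implicit Defensive.

Import Order.TTheory GRing.Theory Num.Theory.
Local Open Scope ring_scope.

Inductive digit := D1 | D2 | D4 | D7.

Definition nat_of_digit (x : digit) : nat :=
  match x with D1 => 1 | D2 => 2 | D4 => 4 | D7 => 7 end.

Lemma nat_of_digit_inj : injective nat_of_digit.
Proof. by case; case. Qed.

HB.instance Definition _ := Equality.copy digit (inj_type nat_of_digit_inj).

Definition word (n : nat) : Type := n.-tuple digit.

Definition gamma_digit (x : digit) : digit :=
  match x with D1 => D2 | D2 => D4 | D4 => D1 | D7 => D7 end.

Definition gamma n (b : word n) : word n := [tuple of map gamma_digit b].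

Definition identity_word n : word n := [tuple of nseq n D7].

Section Plane.
Variable R : realType.

Definition degree (x : R) : R := x * pi / 180.

Definition point (x y : R) : 'rV[R]_2 := \row_(j < 2) if j == 0 then x else y.

Definition polar_unit (t : R) : 'rV[R]_2 :=
  point (cos (degree t)) (sin (degree t)).

Definition v (x : digit) : 'rV[R]_2 :=
  match x with
  | D1 => polar_unit 210
  | D2 => polar_unit 90
  | D4 => polar_unit 330
  | D7 => point 0 0
  end.

(* Positions are numbered from 0, so the index r : 'I_n below stands for the
   position r + 1 of the word: in particular d_(r+1) = d1 / 2 ^ r. *)
Definition d (d1 : R) (r : nat) : R := d1 / 2 ^+ r.

Definition sigma n (b : word n) (r : 'I_n) : R :=
  (-1) ^+ #|[set s : 'I_n | (s < r)%N && (tnth b s == D7)]|.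

Definition P (d1 : R) n (b : word n) : 'rV[R]_2 :=
  \sum_(r < n) (sigma b r * d d1 r) *: v (tnth b r).

(* The library norm on row vectors is the sup norm, hence this definition. *)
Definition euclidean_dist (p q : 'rV[R]_2) : R :=
  Num.sqrt (\sum_(j < 2) (p 0 j - q 0 j) ^+ 2).

Definition equilateral_triangle (p q r : 'rV[R]_2) : Prop :=
  [/\ p <> q, q <> r & r <> p] /\
  euclidean_dist p q = euclidean_dist q r /\
  euclidean_dist q r = euclidean_dist r p.

End Plane.

(* Main.v *)
Require Import Defs.
From mathcomp Require Import all_boot all_order all_algebra.
From mathcomp Require Import all_classical all_reals all_analysis.
From mathcomp Require Import ring lra.

Import Order.TTheory GRing.Theory Num.Theory.
Local Open Scope ring_scope.

(** The map gamma preserves the signs sigma_r and rotates each v(b_r) by -120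
    degrees, so the three points form one orbit of that rotation about the
    origin.  The orbit of a nonzero point is an equilateral triangle.  Finally
    P b is nonzero: its inner product with v(b_k), for the first b_k <> 7, has a
    leading term of absolute value d_k, which exceeds d_(k+1) + ... + d_n. *)

Section Trigonometry.
Set Implicit Arguments.
Unset Strict Implicit.
Variable R : realType.

Lemma cos_pi6_gt0 : 0 < cos (pi / 6) :> R.
Proof. by apply: cos_gt0_pihalf; have := pi_gt0 R; lra. Qed.

(** Tripling the angle [pi / 6] gives [pi / 2], whose cosine is 0. With [c = cos (pi / 6)] the
    triple-angle formula becomes [c * (4 * c ^ 2 - 3) = 0], and [c > 0]. *)
Lemma sqr_cos_pi6 : cos (pi / 6) ^+ 2 = 3 / 4 :> R.
Proof.
have := cos_pihalf R.
have -> : pi / 2 = pi / 6 + pi / 6 *+ 2 :> R by field.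
rewrite cosD cos_mulr2n sin_mulr2n => h.
have h2 := sin2cos2 (pi / 6 : R).
have /eqP : cos (pi / 6) * (4 * cos (pi / 6) ^+ 2 - 3) = 0 :> R.
  rewrite -[RHS]h.
  transitivity (cos (pi / 6) * (cos (pi / 6) ^+ 2 *+ 2 - 1)
    - 2 * cos (pi / 6) * (1 - cos (pi / 6) ^+ 2) : R); first by ring.
  by rewrite -h2; ring.
by rewrite mulf_eq0 (gt_eqF cos_pi6_gt0) /= => /eqP; lra.
Qed.

Lemma sin_pi6 : sin (pi / 6) = 1 / 2 :> R.
Proof.
have s0 : 0 < sin (pi / 6) :> R.
  by apply: sin_gt0_pihalf; have := pi_gt0 R; lra.
have /eqP : (sin (pi / 6) - 1 / 2) * (sin (pi / 6) + 1 / 2) = 0 :> R.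
  by rewrite -subr_sqr sin2cos2 sqr_cos_pi6; field.
by rewrite mulf_eq0 => /orP [] /eqP; lra.
Qed.

(** [cos (pi / 6)] is left unevaluated: later on, only the value [3 / 4] of its square matters. *)
Lemma v_coord (x : digit) : v R x =
  match x with
  | D1 => Defs.point (- cos (pi / 6)) (- (1 / 2))
  | D2 => Defs.point 0 1
  | D4 => Defs.point (cos (pi / 6)) (- (1 / 2))
  | D7 => Defs.point 0 0
  end.
Proof.
case: x => //=; rewrite /polar_unit /degree.
- have -> : 210 * pi / 180 = pi / 6 + pi :> R by field.
  by rewrite cosDpi sinDpi sin_pi6.
- have -> : 90 * pi / 180 = pi / 2 :> R by field.
  by rewrite cos_pihalf sin_pihalf.
- have -> : 330 * pi / 180 = - (pi / 6) + pi *+ 2 :> R by field.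
  by rewrite cosD2pi sinD2pi cosN sinN sin_pi6.
Qed.

End Trigonometry.

Section Plane.
Set Implicit Arguments.
Unset Strict Implicit.
Variable R : realType.
Implicit Types p q : 'rV[R]_2.

Definition dot p q : R := p 0 0 * q 0 0 + p 0 1 * q 0 1.

Lemma point_eq p q : p 0 0 = q 0 0 -> p 0 1 = q 0 1 -> p = q.
Proof.
move=> h0 h1; apply/rowP => -[[|[|//]] hj].
- by rewrite (_ : Ordinal hj = 0) //; apply: val_inj.
- by rewrite (_ : Ordinal hj = 1) //; apply: val_inj.
Qed.

Lemma dot_sumZl n (a : 'I_n -> R) (u : 'I_n -> 'rV[R]_2) q :
  dot (\sum_(i < n) a i *: u i) q = \sum_(i < n) a i * dot (u i) q.
Proof.
rewrite /dot !summxE !mulr_suml -big_split; apply: eq_bigr => i _ /=.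
by rewrite !mxE; ring.
Qed.

Lemma dot_vv (x : digit) : x != D7 -> dot (v R x) (v R x) = 1.
Proof.
have := sqr_cos_pi6 R.
by case: x => // h _; rewrite v_coord /dot !mxE /= ?mulrN ?mulNr ?opprK -?expr2 ?h;
  field.
Qed.

Lemma dot_v_le1 (x y : digit) : `|dot (v R x) (v R y)| <= 1.
Proof.
have h := sqr_cos_pi6 R; rewrite expr2 in h.
by rewrite ler_norml; case: x; case: y; rewrite !v_coord /dot !mxE /=; lra.
Qed.

(* Right multiplication by this matrix rotates row vectors by -120 degrees. *)
Definition rot120 : 'M[R]_2 := \matrix_(i, j)
  if i == j then - (1 / 2) else if i == 0 then - cos (pi / 6) else cos (pi / 6).

Lemma mul_rot120_0 p : (p *m rot120) 0 0 = - (1 / 2) * p 0 0 + cos (pi / 6) * p 0 1.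
Proof.
rewrite mxE big_ord_recl big_ord1 !mxE /= (_ : lift ord0 ord0 = 1).
  by ring.
exact: val_inj.
Qed.

Lemma mul_rot120_1 p : (p *m rot120) 0 1 = - cos (pi / 6) * p 0 0 - 1 / 2 * p 0 1.
Proof.
rewrite mxE big_ord_recl big_ord1 !mxE /= (_ : lift ord0 ord0 = 1).
  by ring.
exact: val_inj.
Qed.

Lemma v_gamma_digit (x : digit) : v R (gamma_digit x) = v R x *m rot120.
Proof.
have h := sqr_cos_pi6 R; rewrite expr2 in h.
by apply: point_eq; rewrite ?mul_rot120_0 ?mul_rot120_1; case: x;
  rewrite !v_coord !mxE /=; lra.
Qed.

Lemma sqr_euclidean_dist p q :
  \sum_(j < 2) (p 0 j - q 0 j) ^+ 2 = dot (p - q) (p - q).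
Proof.
rewrite big_ord_recl big_ord1 /dot !mxE (_ : lift ord0 ord0 = 1) //.
exact: val_inj.
Qed.

Lemma rot120_isometry p q : dot (p *m rot120) (q *m rot120) = dot p q.
Proof.
have h := sqr_cos_pi6 R.
rewrite /dot !mul_rot120_0 !mul_rot120_1.
(* The mixed terms cancel, and the remaining common factor is [1 / 4 + 3 / 4 = 1]. *)
transitivity ((1 / 4 + cos (pi / 6) ^+ 2) * (p 0 0 * q 0 0 + p 0 1 * q 0 1)).
  by field.
by rewrite h; field.
Qed.

(** A rotation [M] of order 3 satisfies [1 + M + M ^ 2 = 0]. Both [M ^ 3 = 1] and the absence of
    nonzero fixed vectors follow from this relation. *)
Lemma mul_rot120_rot120 p : p *m rot120 *m rot120 = - p - p *m rot120.
Proof.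
(* Multiplying the relation for the squared cosine by each coordinate makes what remains linear. *)
have hc (x : R) : cos (pi / 6) * cos (pi / 6) * x = 3 / 4 * x.
  by rewrite -expr2 sqr_cos_pi6.
have h0 := hc (p 0 0); have h1 := hc (p 0 1).
by apply: point_eq; rewrite ?mul_rot120_0 ?mul_rot120_1 2![in RHS]mxE [in RHS]mxE
  ?mul_rot120_0 ?mul_rot120_1; lra.
Qed.

Lemma rot120_cube p : p *m rot120 *m rot120 *m rot120 = p.
Proof. by rewrite !mul_rot120_rot120 opprB opprK addKr. Qed.

Lemma rot120_fixed p : p *m rot120 = p -> p = 0.
Proof.
move=> hp; have /eqP : 3%:R *: p = 0.
  have := mul_rot120_rot120 p; rewrite !hp => /eqP; rewrite -subr_eq0 => /eqP <-.
  by rewrite scaler_nat opprB opprK mulrSr mulr2n addrA.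
by rewrite scaler_eq0 pnatr_eq0 => /eqP.
Qed.

Lemma equilateral_rot120_orbit p :
  p != 0 -> equilateral_triangle p (p *m rot120) (p *m rot120 *m rot120).
Proof.
move=> /eqP p0.
have dist q r : euclidean_dist (q *m rot120) (r *m rot120) = euclidean_dist q r.
  by rewrite /euclidean_dist !sqr_euclidean_dist -mulmxBl rot120_isometry.
have n1 : p <> p *m rot120 by move=> /esym /rot120_fixed.
have back q r : q *m rot120 = r *m rot120 -> q = r.
  by move=> /(congr1 (fun u => u *m rot120 *m rot120)); rewrite !rot120_cube.
split; first split.
- by [].
- by move=> /back.
- by rewrite -{2}[p]rot120_cube => /back /back.
(* Writing the last vertex [p] as its third rotate makes the closing side a rotated copy of the
   first one. *)
- by split; rewrite ?dist // -{4}[p]rot120_cube !dist.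
Qed.

End Plane.

Section DyadicSum.
Set Implicit Arguments.
Unset Strict Implicit.
Variable R : realType.

(** The Horner form of the sum, which drives the two inductions below. *)
Lemma dyadic_sum_recl n (c : 'I_n.+1 -> R) :
  \sum_(i < n.+1) c i / 2 ^+ i =
  c ord0 + (\sum_(i < n) c (lift ord0 i) / 2 ^+ i) / 2.
Proof.
rewrite big_ord_recl expr0 divr1 mulr_suml; congr (_ + _).
by apply: eq_bigr => i _; rewrite lift0 exprSr invfM mulrA.
Qed.

(** In the induction, [1 + 2 / 2 = 2]. The bound is strict because the sum is finite, and this
    strictness lets a leading term outweigh its tail. *)
Lemma dyadic_sum_lt2 n (c : 'I_n -> R) :
  (forall i, `|c i| <= 1) -> `|\sum_(i < n) c i / 2 ^+ i| < 2.
Proof.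
elim: n c => [|n IH] c hc; first by rewrite big_ord0 normr0.
rewrite dyadic_sum_recl.
have := IH (fun i => c (lift ord0 i)) (fun i => hc _).
by have := hc ord0; rewrite ler_norml !ltr_norml; lra.
Qed.

Lemma dyadic_sum_neq0 n (c : 'I_n -> R) (k : 'I_n) :
  (forall i, `|c i| <= 1) -> (forall i : 'I_n, (i < k)%N -> c i = 0) ->
  `|c k| = 1 -> \sum_(i < n) c i / 2 ^+ i != 0.
Proof.
elim: n c k => [c [] //|n IH] c k hc h0 hk.
rewrite dyadic_sum_recl.
have [j kj|k0] := unliftP ord0 k.
  (* For [k > 0] the head coefficient vanishes, so the sum is half of a sum whose leading index is
     [j = k - 1]. *)
  rewrite h0 ?kj ?lift0 // add0r mulf_neq0 ?invr_neq0 ?pnatr_eq0 //.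
  apply: (IH _ j) => [i|i ij|]; first exact: hc.
    by apply: h0; rewrite kj !lift0.
  by rewrite -kj.
(* For [k = 0] the head is 1 or -1, while the halved tail is less than 1 in absolute value. *)
have := @dyadic_sum_lt2 n (fun i => c (lift ord0 i)) (fun i => hc _).
rewrite k0 in hk; rewrite ltr_norml => hS; apply/eqP => hE.
by move: hk; have [_|_] := ger0P (c ord0); lra.
Qed.

End DyadicSum.

Section Centroid.
Set Implicit Arguments.
Unset Strict Implicit.
Variables (R : realType) (n : nat).
Implicit Types b : word n.

(** [gamma] fixes 7 and sends no other digit to 7, so the positions of the sevens do not change. *)
Lemma sigma_gamma b (r : 'I_n) : sigma R (gamma b) r = sigma R b r.
Proof.
rewrite /sigma; congr (_ ^+ #|pred_of_set _|); apply/setP => s.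
by rewrite !inE tnth_map; case: (tnth b s).
Qed.

Lemma P_gamma (d1 : R) b : P d1 (gamma b) = P d1 b *m rot120 R.
Proof.
rewrite /P mulmx_suml; apply: eq_bigr => r _.
by rewrite sigma_gamma tnth_map v_gamma_digit scalemxAl.
Qed.

Lemma P_neq0 (d1 : R) b : 0 < d1 -> b <> identity_word n -> P d1 b != 0.
Proof.
move=> d1_gt0 hb.
have [k0 hk0] : exists k, tnth b k != D7.
  apply/existsP; apply: contra_notT hb; rewrite negb_exists => /forallP h.
  apply: eq_from_tnth => i; rewrite tnth_nseq.
  by have := h i; rewrite negbK => /eqP.
(* [k] is the first position whose digit is not 7; all earlier vectors vanish. *)
have [k hk kmin] :=
  @arg_minnP _ k0 (fun i => tnth b i != D7) (fun i : 'I_n => i : nat) hk0.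
(* The inner product of [P d1 b] with [v(b_k)] is [d1] times the dyadic sum of these coefficients;
   the signs do not affect their absolute values. *)
pose c i := sigma R b i * dot (v R (tnth b i)) (v R (tnth b k)).
have normc i : `|c i| = `|dot (v R (tnth b i)) (v R (tnth b k))|.
  by rewrite normrM /sigma normrX normrN1 expr1n mul1r.
have : \sum_(i < n) c i / 2 ^+ i != 0.
  apply: (@dyadic_sum_neq0 R n c k) => [i|i ik|].
  - by rewrite normc dot_v_le1.
  - have /eqP b7 : tnth b i == D7.
      by apply: contraLR ik => /kmin; rewrite -leqNgt.
    by rewrite /c b7 v_coord /dot !mxE /= !mul0r addr0 mulr0.
  - by rewrite normc dot_vv // normr1.
(* If [P d1 b] were 0, that inner product would vanish, and cancelling [d1 > 0] would make the
   dyadic sum 0. *)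
apply: contraNneq => P0.
have := dot_sumZl (fun i => sigma R b i * d d1 i) (fun i => v R (tnth b i))
  (v R (tnth b k)).
rewrite -/(P d1 b) P0 /dot !mxE !mul0r addr0 => /esym h.
apply/eqP; apply: (mulfI (lt0r_neq0 d1_gt0)).
rewrite mulr0 -[RHS]h mulr_sumr; apply: eq_bigr => i _.
by rewrite /c /dot /d; ring.
Qed.

End Centroid.

Theorem corollary4p6 (R : realType) (n : nat) (hn : (1 <= n)%N)
  (d1 : R) (hd1 : 0 < d1) (b : word n) (hb : b <> identity_word n) :
  equilateral_triangle (P d1 b) (P d1 (gamma b)) (P d1 (gamma (gamma b))).
Proof. by rewrite !P_gamma; apply/equilateral_rot120_orbit/P_neq0. Qed.
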